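(* Let $X$ be an irreducible affine algebraic variety of dimension $\ge 2$ over an algebraically closed field $\Bbbk$ of characteristic zero, and let $G\subseteq\mathrm{SAut}(X)$ be a subgroup generated by a saturated set $\mathcal{N}$ of locally nilpotent vector fields, which acts with an open orbit $O\subseteq X$. Then $G$ acts infinitely transitively on $O$.
   Context: Write $X=\operatorname{Spec}A$. A locally nilpotent vector field on $X$ is a $\Bbbk$-linear derivation $\partial:A\to A$ such that for every $a\in A$ there is $n$ with $\partial^n(a)=0$; it is also viewed as a vector field on $X$. It generates the subgroup $\exp(\Bbbk\partial)$ of $\mathrm{Aut}(A)\cong\mathrm{Aut}(X)$, which for $\partial\ne0$ is a one-parameter unipotent subgroup, i.e. an algebraic subgroup isomorphic to $\mathbb{G}_a$. $\mathrm{SAut}(X)$ is the subgroup of $\mathrm{Aut}(X)$ generated by all one-parameter unipotent subgroups. The group generated by a set $\mathcal{N}$ of locally nilpotent vector fields is the group generated by all $\exp(\Bbbk\partial)$, $\partial\in\mathcal{N}$. A set $\mathcal{N}$ of locally nilpotent vector fields on $X$, generating the group $G$, is saturated if (1) $\mathcal{N}$ is closed under conjugation by elements of $G$ (i.e. $g^*\circ\partial\circ(g^* )^{-1}\in\mathcal{N}$ for $\partial\in\mathcal{N}$, $g\in G$), and (2) $\mathcal{N}$ is closed under taking replicas, i.e. $f\partial\in\mathcal{N}$ for all $\partial\in\mathcal{N}$ and $f\in\ker\partial$. A group acts infinitely transitively on a set if for every $m\ge1$ it acts $m$-transitively, i.e. any $m$-tuple of pairwise distinct points can be mapped to any other such $m$-tuple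 by a group element. *)

(* Defs.v *)
From HB Require Import structures.
From mathcomp Require Import all_boot all_order all_algebra.
From mathcomp Require Import boolp classical_sets functions.

Set Implicit Arguments.
Unset Strict Implicit.
Unset Printing Implicit Defensive.

Import GRing.Theory.

Local Open Scope classical_set_scope.
Local Open Scope ring_scope.

(* The affine variety X = Spec A is given by its coordinate algebra A; a point
   of X is a k-algebra morphism A -> k (evaluation at the point), and an
   automorphism g of X is given by its comorphism g^* : A -> A. Functional
   extensionality makes Leibniz equality the right equality for both. *)

Section AffineVariety.
Variables (k : closedFieldType) (A : comAlgType k).

(* Every k-subalgebra containing the finite sequence s is the whole of A. *)
Definition finitely_generated_algebra : Prop :=
  exists s : seq A, forall S : {pred A},
    subalg_closed S -> {subset s <= S} -> forall a, a \in S.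

Definition prime_ideal (P : {pred A}) : Prop :=
  idealr_closed P /\ prime_idealr_closed P.

(* Krull dimension at least n: a strict chain P_0 < P_1 < ... < P_n of primes
   (the values P i for i > n are irrelevant). *)
Definition dimension_ge (n : nat) : Prop :=
  exists P : nat -> {pred A},
    (forall i, (i <= n)%N -> prime_ideal (P i)) /\
    (forall i, (i < n)%N ->
       {subset P i <= P i.+1} /\ ~ {subset P i.+1 <= P i}).

Definition irreducible_affine_variety : Prop :=
  GRing.integral_domain_axiom A /\ finitely_generated_algebra.

Definition points : set (A -> k) :=
  [set x : A -> k | scalar x /\ monoid_morphism x].

Definition zero_locus (I : set A) : set (A -> k) :=
  [set x | points x /\ forall a, I a -> x a = 0].

Definition zariski_open (U : set (A -> k)) : Prop :=
  exists I : set A, U = points `\` zero_locus I.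

Definition automorphism : set (A -> A) :=
  [set g : A -> A | [/\ linear g, monoid_morphism g & bijective g]].

Definition is_subgroup (H : set (A -> A)) : Prop :=
  [/\ H `<=` automorphism,
      H idfun,
      forall g h, H g -> H h -> H (g \o h)
    & forall g g', H g -> cancel g g' -> cancel g' g -> H g'].

Definition generated_subgroup (S : set (A -> A)) : set (A -> A) :=
  smallest is_subgroup S.

Definition locally_nilpotent_derivation : set (A -> A) :=
  [set d : A -> A | [/\ linear d,
      forall a b, d (a * b) = d a * b + a * d b
    & forall a, exists n, iter n d a = 0]].

(* Truncating the exponential series at any n with d^n a = 0 gives the same
   value; xget picks one such n. *)
Definition lnd_exp (d : A -> A) (a : A) : A :=
  \sum_(i < xget 0%N [set n | iter n d a = 0]) (i`!%:R : k)^-1 *: iter i d a.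

Definition exp_subgroup (d : A -> A) : set (A -> A) :=
  [set g | exists t : k, g = lnd_exp (fun a => t *: d a)].

Definition group_generated_by_lnds (N : set (A -> A)) : set (A -> A) :=
  generated_subgroup (\bigcup_(d in N) exp_subgroup d).

(* The image of an injective morphism phi from (k, +) to Aut(A) such that the
   action G_a x X -> X is a morphism of varieties: each regular function a
   pulls back to an element of k[T] (x) A = A[T], with value phi t a at T = t. *)
Definition one_parameter_unipotent_subgroup (H : set (A -> A)) : Prop :=
  exists phi : k -> (A -> A),
    [/\ forall t, automorphism (phi t),
        forall s t, phi (s + t) = phi s \o phi t,
        injective phi,
        forall a, exists p : {poly A}, forall t, phi t a = p.[t%:A]
      & H = range phi].

Definition SAut : set (A -> A) :=
  generated_subgroup (\bigcup_(H in one_parameter_unipotent_subgroup) H).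

Definition saturated (N : set (A -> A)) : Prop :=
  (forall d g g', N d -> group_generated_by_lnds N g ->
     cancel g g' -> cancel g' g -> N (g \o d \o g')) /\
  (forall d f, N d -> d f = 0 -> N (fun a => f * d a)).

(* The automorphism of X with comorphism g sends the point x to x \o g. *)
Definition point_orbit (G : set (A -> A)) (x : A -> k) : set (A -> k) :=
  [set x \o g | g in G].

Definition infinitely_transitive (G : set (A -> A)) (O : set (A -> k)) : Prop :=
  forall m, (1 <= m)%N -> forall x y : 'I_m -> (A -> k),
    (forall i, O (x i)) -> (forall i, O (y i)) ->
    injective x -> injective y ->
    exists2 g, G g & forall i, x i \o g = y i.

End AffineVariety.

Arguments finitely_generated_algebra {k} A.
Arguments dimension_ge {k} A n.
Arguments irreducible_affine_variety {k} A.
Arguments points {k} A _ /.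
Arguments automorphism {k} A _ /.
Arguments locally_nilpotent_derivation {k} A _ /.
Arguments SAut {k} A _.

(* Main.v *)
Require Import Defs.
From HB Require Import structures.
From mathcomp Require Import all_boot all_order all_algebra.
From mathcomp Require Import boolp classical_sets functions.
From mathcomp Require Import ring.

Set Implicit Arguments.
Unset Strict Implicit.
Unset Printing Implicit Defensive.

Import GRing.Theory.

Local Open Scope classical_set_scope.
Local Open Scope ring_scope.

(** Infinite transitivity amounts to this: for every finite family Z of points of
    O, the pointwise stabiliser G_Z of Z in G is transitive on O \ Z
    ([fixing_orbit_all]). G acts on points on the right, x g being x \o g.

    Elements of G_Z come from replicas. If e is in N and f in its kernel vanishes
    on Z but not at p, then the exponential of (f / f(p)) e fixes Z and moves p as
    exp e does ([fixing_orbit_exp]). This has two consequences.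

    - For g in G and p generic, p g lies in the G_Z-orbit of p
      ([fixing_orbit_generic]). For g = exp e one needs a nonzero f in the kernel of
      e that vanishes on Z, hence a nonconstant element of that kernel, and this is
      where dimension at least 2 enters: if the kernel of e were k, then A would be
      k[s] ([ker_nonconstant]).

    - For p in O \ Z, the G_Z-orbit of p is dense ([fixing_orbit_dense]). The kernel
      of e may be unable to separate p from Z, but the kernel of a generic conjugate
      of e separates them. Indeed, for each z in Z, some conjugate of e separates p
      and z ([separation]), and conditions of this kind, each satisfied somewhere on
      G, are satisfied together, because G is irreducible: any two of its elements
      are joined by a chain of affine lines t |-> g exp(t d), along which everything
      in sight is polynomial ([group_irreducible]).

    Given x and y = x g in O \ Z, let W be the union of Z and Z g^-1. By density,
    some h in G_W moves x to a point x h at which the first consequence applies to Z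
    and g. So x, x h and x h g lie in one G_Z-orbit; and x h g = y (g^-1 h g), where
    g^-1 h g fixes Z.

    The separation property rests on local slices: if d s is nonzero and killed by
    d, then A and (ker d)[s] agree after inverting d s ([slice_localization]).

    Density of O in X, in the form that a nonzero function does not vanish
    identically on O, is the Nullstellensatz for A ([nullstellensatz]), proved by
    adjoining the generators of A one at a time. *)

(** * Exponentials of locally nilpotent derivations *)

Section Exponentials.
Variables (k : closedFieldType) (A : comAlgType k).
Hypothesis chark0 : [pchar k] =i pred0.

Lemma natr_neq0 n : (0 < n)%N -> n%:R != 0 :> k.
Proof. by move=> n0; rewrite (pcharf0P _).1 // -lt0n. Qed.

Lemma fact_neq0 n : n`!%:R != 0 :> k.
Proof. exact/natr_neq0/fact_gt0. Qed.

Lemma linear_pack (d : A -> A) : linear d -> exists D : {linear A -> A}, d = D.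
Proof.
move=> lin.
by exists (HB.pack_for {linear A -> A} d (GRing.isLinear.Build _ _ _ _ d lin)).
Qed.

Lemma morphism_pack (g : A -> A) :
  linear g -> monoid_morphism g -> exists h : {lrmorphism A -> A}, g = h.
Proof.
move=> lin mor.
by exists (HB.pack_for {lrmorphism A -> A} g (GRing.isLinear.Build _ _ _ _ g lin)
                     (GRing.isMonoidMorphism.Build _ _ g mor)).
Qed.

Lemma point_pack (x : A -> k) :
  points A x -> exists y : {lrmorphism A -> k | *%R}, x = y.
Proof.
move=> [lin mor].
by exists (HB.pack_for {lrmorphism A -> k | *%R} x (GRing.isLinear.Build k A k *%R x lin)
                     (GRing.isMonoidMorphism.Build _ _ x mor)).
Qed.

Lemma iter_linear (d : A -> A) n : linear d -> linear (iter n d).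
Proof. by move=> lin; elim: n => // n IHn t a b /=; rewrite IHn lin. Qed.

Lemma iter_eq0 (d : A -> A) a m n :
  linear d -> iter m d a = 0 -> (m <= n)%N -> iter n d a = 0.
Proof.
move=> /(@iter_linear d (n - m))/linear_pack [D defD] dma0 le_mn.
by rewrite -(subnK le_mn) iterD dma0 defD linear0.
Qed.

Lemma lnd_expE (d : A -> A) a n : linear d -> iter n d a = 0 ->
  lnd_exp d a = \sum_(i < n) (i`!%:R : k)^-1 *: iter i d a.
Proof.
move=> lin dna0; rewrite /lnd_exp.
set m := xget _ _.
have dma0 : iter m d a = 0.
  by apply: (xgetPex 0%N (P := [set n | iter n d a = 0])); exists n.
have widen p q : (p <= q)%N -> iter p d a = 0 ->
    \sum_(i < p) (i`!%:R : k)^-1 *: iter i d a =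
    \sum_(i < q) (i`!%:R : k)^-1 *: iter i d a.
  move=> le_pq dpa0.
  rewrite -!(big_mkord predT (fun i => (i`!%:R : k)^-1 *: iter i d a)).
  rewrite (big_cat_nat _ le_pq) //= [X in _ + X]big_nat_cond [X in _ + X]big1 ?addr0 //.
  by move=> i /andP[/andP[le_pi _] _]; rewrite (iter_eq0 lin dpa0 le_pi) scaler0.
by case: (leqP m n) => [/widen->|/ltnW/widen->].
Qed.

(** The powers of f come out because f, and hence every power of f, is killed
    by d. This is what makes the flow of a replica readable at a point: there it
    is the flow of d with the time rescaled by the value of f. *)
Lemma iter_replica (d : A -> A) (f : A) i a :
    linear d -> (forall a b, d (a * b) = d a * b + a * d b) -> d f = 0 ->
  iter i (fun a => f * d a) a = f ^+ i * iter i d a.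
Proof.
move=> lin leib df0; elim: i => [|i IHi]; first by rewrite mul1r.
have dfX : d (f ^+ i) = 0.
  elim: i {IHi} => [|i IHi].
    have := leib 1 1; rewrite expr0 !mulr1 mul1r => e.
    by apply: (@addrI _ (d 1)); rewrite -e addr0.
  by rewrite exprS leib df0 IHi mul0r mulr0 addr0.
by rewrite /= IHi leib dfX mul0r add0r mulrA -exprS.
Qed.

Lemma iter_scale (d : A -> A) (t : k) i a : linear d ->
  iter i (fun a => t *: d a) a = t ^+ i *: iter i d a.
Proof.
case/linear_pack=> D ->; elim: i => [|i IHi]; first by rewrite scale1r.
by rewrite /= IHi linearZ scalerA -exprS.
Qed.

Lemma lnd_expZ (d : A -> A) t a n : linear d -> iter n d a = 0 ->
  lnd_exp (fun a => t *: d a) a = \sum_(i < n) (t ^+ i / i`!%:R) *: iter i d a.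
Proof.
move=> lin dna0; rewrite (@lnd_expE _ _ n); last by rewrite iter_scale // dna0 scaler0.
  by apply: eq_bigr => i _; rewrite iter_scale // scalerA mulrC.
case/linear_pack: lin => D -> s a1 b1.
by rewrite linearP scalerDr !scalerA mulrC.
Qed.

Lemma replica_lnd (d : A -> A) f : locally_nilpotent_derivation A d -> d f = 0 ->
  locally_nilpotent_derivation A (fun a => f * d a).
Proof.
move=> [lin leib nil] df0; split.
- by move=> t a b; rewrite lin mulrDr -scalerAr.
- by move=> a b; rewrite leib mulrDr mulrA [f * (a * _)]mulrCA.
- by move=> a; have [n dna0] := nil a; exists n; rewrite iter_replica // dna0 mulr0.
Qed.

Lemma lnd1 (d : A -> A) : locally_nilpotent_derivation A d -> d 1 = 0.
Proof.
move=> [_ leib _]; have := leib 1 1; rewrite !mulr1 mul1r => e.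
by apply: (@addrI _ (d 1)); rewrite -e addr0.
Qed.

Lemma lndA (d : A -> A) c : locally_nilpotent_derivation A d -> d c%:A = 0.
Proof.
move=> lnd; have := lnd1 lnd; have [/linear_pack [D ->] _ _] := lnd.
by move=> D1; rewrite linearZ /= D1 scaler0.
Qed.

Lemma lnd_exp_linear (d : A -> A) :
  locally_nilpotent_derivation A d -> linear (lnd_exp d).
Proof.
move=> [lin leib nil] t a b.
have [m ma0] := nil a; have [n nb0] := nil b.
have ma : iter (maxn m n) d a = 0 by apply: iter_eq0 ma0 _; rewrite ?leq_maxl.
have mb : iter (maxn m n) d b = 0 by apply: iter_eq0 nb0 _; rewrite ?leq_maxr.
rewrite (lnd_expE lin ma) (lnd_expE lin mb).
rewrite (@lnd_expE _ _ (maxn m n)) //; last first.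
  by rewrite iter_linear //= ma mb scaler0 addr0.
rewrite scaler_sumr -big_split; apply: eq_bigr => i _ /=.
by rewrite iter_linear // scalerDr !scalerA mulrC.
Qed.

Lemma lnd_exp_killed (d : A -> A) a : locally_nilpotent_derivation A d ->
  d a = 0 -> lnd_exp d a = a.
Proof.
move=> [lin _ _] da0; rewrite (@lnd_expE _ _ 1) //.
by rewrite big_ord1 /= invr1 scale1r.
Qed.

(** On a fixed a the operators exp d and exp (- d) act as truncated exponential
    series in d, so their composite is governed by the identity
    exp(X) exp(- X) = 1 modulo X^n, where d^n a = 0. *)
Lemma lnd_expN (d : A -> A) : locally_nilpotent_derivation A d ->
  cancel (lnd_exp d) (lnd_exp (fun a => -1 *: d a)).
Proof.
move=> lnd a; have [lin leib nil] := lnd; have [n na0] := nil a.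
have lndN : locally_nilpotent_derivation A (fun a => -1 *: d a).
  have := replica_lnd lnd (lndA (-1) lnd).
  by congr (locally_nilpotent_derivation A _); apply: funext => b; rewrite mulr_algl.
have [E defE] := linear_pack (lnd_exp_linear lndN); rewrite defE.
rewrite (lnd_expE lin na0) linear_sum /=.
have {defE} eE i : E (iter i d a) =
    \sum_(j < n) ((-1) ^+ j / j`!%:R) *: iter (i + j) d a.
  rewrite -defE (@lnd_expZ _ _ _ n) //.
    by apply: eq_bigr => j _; rewrite addnC iterD.
  by rewrite -iterD (iter_eq0 lin na0) ?leq_addr.
under eq_bigr => i _ do rewrite linearZ eE.
(* L evaluates a polynomial at d and applies the result to a; it only sees
   polynomials modulo X^n *)
pose L (p : {poly k}) := \sum_(m < n) p`_m *: iter m d a.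
have LE : linear L.
  move=> t p q; rewrite /L scaler_sumr -big_split; apply: eq_bigr => i _.
  by rewrite coefD coefZ scalerDl scalerA.
have LX m : L 'X^m = iter m d a.
  rewrite /L; case: (ltnP m n) => [lt_mn|le_nm].
    rewrite (bigD1 (Ordinal lt_mn)) //= coefXn eqxx scale1r big1 ?addr0 // => i.
    by rewrite -val_eqE coefXn /= => /negPf ->; rewrite scale0r.
  rewrite (iter_eq0 lin na0 le_nm) big1 // => i _.
  by rewrite coefXn ltn_eqF ?scale0r // (leq_trans (ltn_ord i)).
pose LL : {linear {poly k} -> A} := HB.pack_for {linear {poly k} -> A} L
   (GRing.isLinear.Build _ _ _ _ L LE).
pose p : {poly k} := \poly_(i < n) (i`!%:R)^-1.
pose q : {poly k} := \poly_(j < n) ((-1) ^+ j / j`!%:R).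
transitivity (LL (p * q)).
  rewrite {1}/p poly_def mulr_suml linear_sum; apply: eq_bigr => i _.
  rewrite -scalerAl [LHS]/= linearZ; congr (_ *: _).
  rewrite /q poly_def mulr_sumr linear_sum; apply: eq_bigr => j _.
  by rewrite -scalerAr linearZ -exprD /= LX.
rewrite /LL /= /L.
have pq m : (m < n)%N -> (p * q)`_m = (m == 0%N)%:R.
  move=> lt_mn; rewrite coefM.
  transitivity ((m`!%:R : k)^-1 * (-1 + 1) ^+ m); last first.
    by rewrite addNr expr0n; case: m {lt_mn} => [|m]; rewrite ?invr1 ?mulr1 ?mulr0.
  rewrite exprDn mulr_sumr; apply: eq_bigr => i _.
  have le_im : (i <= m)%N by rewrite -ltnS.
  rewrite !coef_poly (leq_ltn_trans le_im lt_mn) (leq_ltn_trans (leq_subr i m) lt_mn).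
  rewrite expr1n mulr1 -mulr_natr -(bin_fact le_im) !natrM.
  have b0 : 'C(m, i)%:R != 0 :> k by rewrite natr_neq0 // bin_gt0.
  by field; rewrite b0 !fact_neq0.
transitivity (\sum_(m < n) (m == 0%N :> nat)%:R *: iter m d a).
  by apply: eq_bigr => m _; rewrite pq.
case: n na0 {LL L LE LX eE pq p q} => [<-|n _]; first by rewrite big_ord0.
by rewrite big_ord_recl /= scale1r big1 ?addr0 // => i _; rewrite scale0r.
Qed.
End Exponentials.

(** * The Nullstellensatz *)

Section Nullstellensatz.
Variables (k : closedFieldType) (A : comAlgType k).
Hypothesis domA : GRing.integral_domain_axiom A.

Lemma domain_mulf_neq0 (a b : A) : a != 0 -> b != 0 -> a * b != 0.
Proof.
move=> a0 b0; apply/eqP => /domA; by rewrite (negPf a0) (negPf b0).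
Qed.

Lemma domain_expf_neq0 (a : A) n : a != 0 -> a ^+ n != 0.
Proof.
by move=> a0; elim: n => [|n IHn]; rewrite ?oner_neq0 // exprS domain_mulf_neq0.
Qed.

Lemma domain_mulfI (a b : A) : a != 0 -> a * b = 0 -> b = 0.
Proof. by move=> a0 /domA; rewrite (negPf a0) => /eqP. Qed.

(** Here R stands for a ring of polynomials over k and f for its evaluation in
    A. A point of the subalgebra f(R) is encoded as a morphism phi from R to k
    that kills the kernel of f, and iota is the inclusion of the constants, so
    that cancelling iota expresses k-linearity. The property says that every
    nonempty principal open subset of f(R) has a point. *)
Definition lifts_points (R : comNzRingType) (iota : k -> R) (f : R -> A) : Prop :=
  forall b, f b != 0 -> exists phi : {rmorphism R -> k},
    [/\ cancel iota phi, forall r, f r = 0 -> phi r = 0 & phi b != 0].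

(** Coefficients in the kernel of f are invisible in A, so the leading ones
    can be dropped. *)
Lemma truncate_poly (R : nzRingType) (f : {rmorphism R -> A}) (p : {poly R}) :
  map_poly f p != 0 -> exists p', [/\ map_poly f p' = map_poly f p,
    size p' = size (map_poly f p) & f (lead_coef p') != 0].
Proof.
move=> fp0; set n := size (map_poly f p).
have n0 : (0 < n)%N by rewrite size_poly_gt0.
pose p' := \poly_(i < n) p`_i.
have fpn : f p`_n.-1 != 0 by rewrite -coef_map -lead_coefE lead_coef_eq0.
have pn : p`_n.-1 != 0 by apply: contraNneq fpn => ->; rewrite rmorph0.
exists p'; split; first 2 last.
- by rewrite lead_coef_poly.
- apply/polyP => i; rewrite coef_map coef_poly; case: ltnP => [_|le_ni].
    by rewrite coef_map.
  by rewrite raddf0 nth_default.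
- by rewrite /p' size_poly_eq.
Qed.

(** A generator s is adjoined to the subalgebra f(R), and a point of f(R) has to
    be extended to s. If s is transcendental over f(R), any value t of s
    defines a point, and b is nonzero at almost all of them, provided that its
    leading coefficient does not vanish at the given point. If s is algebraic,
    take a polynomial q of least degree that vanishes at s; pseudo-division by q shows that any root t of the image of q
    defines a point, as soon as the leading coefficient of q does not vanish at
    the given point of f(R). For b not to vanish at the new point, it is enough
    that some nonzero multiple of b lies in f(R) and does not vanish there. *)
Lemma lifts_points_adjoin (R : idomainType) (iota : k -> R)
    (f : {rmorphism R -> A}) (s : A) (cfs : commr_rmorph f s) :
  lifts_points iota f ->
  lifts_points (fun t => (iota t)%:P) (horner_morph cfs).
Proof.
pose F : {rmorphism {poly R} -> A} := horner_morph cfs.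
move=> liftf b Fb0.
have FE p : F p = (map_poly f p).[s] by [].
have FC c : F c%:P = f c by rewrite FE map_polyC hornerC.
have map0F p : map_poly f p = 0 -> F p = 0 by rewrite FE => ->; rewrite horner0.
have mapF0 p : F p != 0 -> map_poly f p != 0.
  by apply: contraNneq => /map0F ->.
(* the point of f(R)[s] is evaluation at t of polynomials reduced by phi *)
suff [phi [t [phiK killf killF b0]]] : exists (phi : {rmorphism R -> k}) (t : k),
    [/\ cancel iota phi, forall r, f r = 0 -> phi r = 0,
        forall p, F p = 0 -> (map_poly phi p).[t] = 0 & (map_poly phi b).[t] != 0].
  have cphi : commr_rmorph phi t by move=> r; apply: mulrC.
  exists (horner_morph cphi); split=> // u.
  by rewrite /= horner_morphC phiK.
have map0 (phi : {rmorphism R -> k}) : (forall r, f r = 0 -> phi r = 0) ->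
    forall p, map_poly f p = 0 -> map_poly phi p = 0.
  move=> killf p fp0; apply/polyP => i; rewrite coef_map coef0; apply: killf.
  by rewrite -coef_map fp0 coef0.
(* s is either algebraic or transcendental over f(R) *)
have [alg|] := pselect (exists q, F q = 0 /\ map_poly f q != 0); last first.
  move=> transc.
  have {}transc p : F p = 0 -> map_poly f p = 0.
    by move=> Fp0; apply/eqP/negPn/negP => fp0; apply: transc; exists p.
  have [b' [bb' _ lb']] := truncate_poly (mapF0 _ Fb0).
  have [phi [phiK killf phi_b']] := liftf _ lb'.
  have: map_poly phi b' != 0.
    by rewrite -size_poly_gt0 size_map_poly_id0 // size_poly_gt0 -lead_coef_eq0;
       apply: contraNneq phi_b' => ->; rewrite rmorph0.
  move/closed_nonrootP => [t /negP rt]; exists phi, t; split=> //.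
    by move=> p /transc /(map0 _ killf) ->; rewrite horner0.
  have -> : map_poly phi b = map_poly phi b'; last by apply/negP.
  have /eqP : map_poly phi (b - b') = 0.
    by apply: map0 killf _ _; rewrite rmorphB /= bb' subrr.
  by rewrite rmorphB subr_eq0 => /eqP.
have exq : exists n, `[< exists q, [/\ F q = 0, f (lead_coef q) != 0 & size q = n] >].
  have [q [Fq0 fq0]] := alg; have [q' [qq' _ lq']] := truncate_poly fq0.
  exists (size q'); apply/asboolP; exists q'; split=> //.
  by rewrite FE qq' -FE.
case: (ex_minnP exq) => n /asboolP [q [Fq0 lq <-]] minq {exq alg n}.
have {}minq p : F p = 0 -> (size (map_poly f p) < size q)%N -> map_poly f p = 0.
  move=> Fp0 lt_pq; apply/eqP/negPn/negP => fp0.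
  have [p' [pp' sp' lp']] := truncate_poly fp0.
  have /minq : `[< exists q, [/\ F q = 0, f (lead_coef q) != 0 & size q = size p'] >].
    by apply/asboolP; exists p'; split; rewrite // FE pp' -FE.
  by rewrite sp' leqNgt lt_pq.
have q0 : q != 0 by rewrite -lead_coef_eq0; apply: contraNneq lq => ->; rewrite rmorph0.
have FZ c p : F (c *: p) = f c * F p by rewrite -mul_polyC rmorphM FC.
have le_map p : (size (map_poly f p) <= size p)%N by apply: size_poly.
(* The ideal generated by b in f(R)[s] meets f(R): a nonzero element of it of
   least degree r in s divides q up to constants and a remainder that vanishes
   at s, so the minimality of q leaves only degree 0 for r. *)
have [u [e [ub fe0]]] : exists u e, F u * F b = f e /\ f e != 0.
  have exr : exists n, `[< exists r w, [/\ F r != 0, F r = F w * F b & size r = n] >].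
    by exists (size b); apply/asboolP; exists b, 1; rewrite rmorph1 mul1r.
  case: (ex_minnP exr) => n /asboolP [r [w [Fr0 rw <-]]] minr {exr n}.
  have {}minr r' w' : F r' != 0 -> F r' = F w' * F b -> (size r <= size r')%N.
    by move=> r'0 rw'; apply: minr; apply/asboolP; exists r', w'.
  have r0 : r != 0 by apply: contraNneq Fr0 => ->; rewrite rmorph0.
  have lt_rq : (size r < size q)%N.
    apply: (@leq_ltn_trans (size (b %% q))); last by rewrite ltn_modp.
    have e : F (b %% q) = f (lead_coef q ^+ scalp b q) * F b.
      by rewrite -FZ Pdiv.Idomain.divp_eq rmorphD rmorphM Fq0 mulr0 add0r.
    apply: (minr _ (lead_coef q ^+ scalp b q)%:P); last by rewrite FC.
    by rewrite e rmorphXn domain_mulf_neq0 // domain_expf_neq0.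
  have lr : f (lead_coef r) != 0.
    have [r' [rr' sr' lr']] := truncate_poly (mapF0 _ Fr0).
    have Frr' : F r' = F r by rewrite FE rr'.
    have le_r : (size r <= size (map_poly f r))%N.
      by rewrite -sr'; apply: (minr _ w); rewrite Frr'.
    rewrite lead_coefE -coef_map.
    have <- : size (map_poly f r) = size r.
      by apply/eqP; rewrite eqn_leq le_r le_map.
    by rewrite -lead_coefE lead_coef_eq0 mapF0.
  pose v : {poly R} := q %/ r; pose r' : {poly R} := q %% r; pose c := lead_coef r ^+ scalp q r.
  have qE : c *: q = v * r + r' by rewrite Pdiv.Idomain.divp_eq.
  have fc0 : f c != 0 by rewrite rmorphXn domain_expf_neq0.
  have c0 : c != 0 by apply: contraNneq fc0 => ->; rewrite rmorph0.
  have lt_r' : (size r' < size r)%N by rewrite ltn_modp.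
  have Fr' : F r' = - F v * F r.
    have := congr1 F qE; rewrite FZ Fq0 mulr0 rmorphD rmorphM.
    by move/esym/eqP; rewrite addrC addr_eq0 mulNr => /eqP.
  have Fr'0 : F r' = 0.
    apply/eqP/negPn/negP => r'0.
    suff : (size r <= size r')%N by rewrite leqNgt lt_r'.
    by apply: minr r'0 (_ : _ = F (- v * w) * F b); rewrite Fr' rw rmorphM rmorphN mulrA.
  have Fv0 : F v = 0.
    by move/eqP: Fr'; rewrite Fr'0 mulNr eq_sym oppr_eq0 mulrC => /eqP/domain_mulfI; apply.
  have le_qv : (size q <= size v)%N.
    rewrite leqNgt; apply/negP => lt_vq.
    have fv : map_poly f v = 0 by apply: minq Fv0 (leq_ltn_trans (le_map _) lt_vq).
    have fr' : map_poly f r' = 0.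
      by apply: minq Fr'0 (leq_ltn_trans (le_map _) (ltn_trans lt_r' lt_rq)).
    have := congr1 (map_poly f) qE; rewrite rmorphD rmorphM /= fv fr' mul0r addr0.
    move/(congr1 (fun p : {poly A} => p`_(size q).-1)).
    rewrite coef0 coef_map coefZ /= rmorphM => /(domain_mulfI fc0)/eqP.
    by rewrite -lead_coefE (negPf lq).
  have v0 : v != 0.
    by rewrite -size_poly_gt0 (leq_trans _ le_qv) // size_poly_gt0.
  have /size_poly1P [e e0 re] : size r == 1%N.
    rewrite eqn_leq size_poly_gt0 r0 andbT.
    have : (size (v * r)%R <= size q)%N.
      have -> : v * r = c *: q - r' by rewrite qE addrK.
      rewrite (leq_trans (size_polyD _ _)) // size_polyN size_scale // geq_max leqnn.
      by rewrite ltnW // (ltn_trans lt_r').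
    rewrite size_mul // => le_vr.
    have : (size v + size r <= (size v).+1)%N.
      by rewrite (leq_trans (leqSpred _)) // ltnS (leq_trans le_vr).
    by rewrite -addn1 leq_add2l.
  by exists w, e; rewrite -rw -FC -re.
have [|phi [phiK killf phi_ce]] := liftf (lead_coef q * e).
  by rewrite rmorphM domain_mulf_neq0.
move: phi_ce; rewrite rmorphM mulf_eq0 => /norP [phi_q phi_e].
have : size (map_poly phi q) != 1%N.
  rewrite size_map_poly_id0 //; apply/negP => /size_poly1P [c c0 qc].
  by move: lq; rewrite qc lead_coefC -FC -qc Fq0 eqxx.
move/closed_rootP => [t /eqP qt0]; exists phi, t.
have kill p : F p = 0 -> (map_poly phi p).[t] = 0.
  move=> Fp0; have pE := Pdiv.Idomain.divp_eq p q.
  set c := _ ^+ _ in pE.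
  have phic : phi c != 0 by rewrite rmorphXn expf_neq0.
  have: (map_poly phi (c *: p)).[t] = 0.
    rewrite pE rmorphD rmorphM hornerD hornerM qt0 mulr0 add0r.
    rewrite /= (map0 _ killf) ?horner0 //; apply: minq.
      by have := congr1 F pE; rewrite FZ Fp0 mulr0 rmorphD rmorphM Fq0 mulr0 add0r.
    by rewrite (leq_ltn_trans (le_map _)) // ltn_modp.
  rewrite -mul_polyC rmorphM /= map_polyC hornerCM => /eqP.
  by rewrite mulf_eq0 (negPf phic) => /eqP.
split=> //; apply: contraNneq phi_e => b0.
have := kill (u * b - e%:P); rewrite rmorphB rmorphM FC ub subrr => /(_ erefl).
rewrite rmorphB rmorphM hornerD hornerM b0 mulr0 add0r hornerN.
by rewrite /= map_polyC hornerC => /eqP; rewrite oppr_eq0.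
Qed.

(** The rings R of the tower are k, k[X_1], k[X_1][X_2], and so on: genuine
    domains, in which pseudo-division is available. *)
Lemma points_tower (s : seq A) :
  exists (R : idomainType) (iota : {rmorphism k -> R}) (f : {rmorphism R -> A}),
  [/\ forall t, f (iota t) = t%:A, {in s, forall a, exists r, f r = a}
    & lifts_points iota f].
Proof.
elim: s => [|a s [R [iota [f [fi fs lift]]]]].
  exists k, idfun, (GRing.in_alg A); split=> // b b0.
  exists idfun; split=> //.
    by move=> r /eqP; rewrite fmorph_eq0 => /eqP.
  by apply: contraNneq b0 => /= ->; rewrite scale0r.
have cfa : commr_rmorph f a by move=> r; apply: mulrC.
exists {poly R}, (polyC \o iota), (horner_morph cfa); split.
- by move=> t; rewrite /= horner_morphC fi.
- move=> b; rewrite inE => /orP [/eqP->|/fs [r <-]].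
    by exists 'X; rewrite /= horner_morphX.
  by exists r%:P; rewrite /= horner_morphC.
exact: lifts_points_adjoin.
Qed.

(** The tower over a finite set of generators of A ends with a
    surjection onto A, whose points are those of A itself. *)
Theorem nullstellensatz (a : A) : finitely_generated_algebra A ->
  a != 0 -> exists2 x, points A x & x a != 0.
Proof.
move=> [s gen] a0.
have [R [iota [f [fi fs lift]]]] := points_tower s.
have surj b : exists r, f r = b.
  pose S : {pred A} := [pred b | `[< exists r, f r = b >]].
  have : b \in S; last by move/asboolP.
  apply: gen; last by move=> c /fs rc; apply/asboolP.
  split.
  - by apply/asboolP; exists 1; rewrite rmorph1.
  - move=> t u v /asboolP [r <-] /asboolP [r' <-]; apply/asboolP.
    by exists (iota t * r + r'); rewrite rmorphD rmorphM fi mulr_algl.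
  - move=> u v /asboolP [r <-] /asboolP [r' <-]; apply/asboolP.
    by exists (r * r'); rewrite rmorphM.
have [g gK] := choice surj.
have [phi [phiK kill phi_a]] : exists phi : {rmorphism R -> k},
    [/\ cancel iota phi, forall r, f r = 0 -> phi r = 0 & phi (g a) != 0].
  by apply: lift; rewrite gK.
have phi_eq r r' : f r = f r' -> phi r = phi r'.
  move=> e; apply/eqP; rewrite -subr_eq0 -rmorphB kill //.
  by rewrite rmorphB e subrr.
exists (phi \o g) => //; split=> [t u v|].
  rewrite /= -[t in RHS]phiK -rmorphM -rmorphD; apply: phi_eq.
  by rewrite rmorphD rmorphM !gK fi mulr_algl.
split=> [|u v]; rewrite /= -?rmorphM -1?(rmorph1 phi); apply: phi_eq.
  by rewrite gK rmorph1.
by rewrite rmorphM !gK.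
Qed.
End Nullstellensatz.

(** * Local slices *)

Section Slices.
Variables (k : closedFieldType) (A : comAlgType k).
Hypothesis chark0 : [pchar k] =i pred0.

Definition subalgebra (B : set A) : Prop :=
  [/\ B 1, forall (t : k) a b, B a -> B b -> B (t *: a + b)
    & forall a b, B a -> B b -> B (a * b)].

Lemma subalgebraX (B : set A) a n : subalgebra B -> B a -> B (a ^+ n).
Proof.
by move=> [B1 _ BM] Ba; elim: n => // n IHn; rewrite exprS; apply: BM.
Qed.

Variable d : A -> A.
Hypothesis lnd : locally_nilpotent_derivation A d.

Lemma lnd_mul_ker f a : d f = 0 -> d (f * a) = f * d a.
Proof. by have [_ leib _] := lnd; move=> df0; rewrite leib df0 mul0r add0r. Qed.

Lemma iter_mul_ker f a n : d f = 0 -> iter n d (f * a) = f * iter n d a.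
Proof. by move=> df0; elim: n => // n /= ->; rewrite lnd_mul_ker. Qed.

Lemma lndX s n : d (s ^+ n.+1) = n.+1%:R * d s * s ^+ n.
Proof.
have [_ leib _] := lnd; elim: n => [|n IHn]; first by rewrite mulr1 mul1r.
by rewrite exprS leib IHn exprS; ring.
Qed.

Lemma subalgebra_ker : subalgebra [set a | d a = 0].
Proof.
have [lin leib _] := lnd; split=> /= [|t a b|a b].
- exact: lnd1.
- by rewrite lin => /= -> ->; rewrite scaler0 addr0.
- by move=> da db; rewrite leib da db mul0r mulr0 addr0.
Qed.

Lemma lnd_natr n : d n%:R = 0.
Proof. by have := lndA n%:R lnd; rewrite scaler_nat. Qed.

(** Such an s is a local slice of d: d acts on the powers of s as c d/ds with
    the constant c = d s. *)
Lemma iter_slice_exp s n : d (d s) = 0 -> iter n d (s ^+ n) = n`!%:R * d s ^+ n.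
Proof.
move=> dds; elim: n => [|n IHn]; first by rewrite mulr1.
have dc : d (n.+1%:R * d s) = 0 by rewrite lnd_mul_ker ?lnd_natr // dds mulr0.
by rewrite iterSr lndX iter_mul_ker // IHn factS natrM exprS; ring.
Qed.

(** After inverting c = d s, the algebra A is the polynomial ring in s over the
    kernel of d: subtracting from m! c^m a the term with s^m of its Taylor
    expansion in s lowers the order of nilpotency. *)
Lemma slice_localization (B : set A) s : subalgebra B ->
  (forall a, d a = 0 -> B a) -> B s -> d (d s) = 0 ->
  forall a, exists n, B (d s ^+ n * a).
Proof.
move=> algB kerB Bs dds a; have [_ BL BM] := algB; have [lin _ nil] := lnd.
have [D defD] := linear_pack lin.
have [m] := nil a; elim: m a => [|m IHm] a.
  by move=> /= ->; exists 0%N; rewrite mulr0; apply: kerB; rewrite defD linear0.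
rewrite iterS => da; set c := d s; set am := iter m d a in da.
have [Dm defDm] := linear_pack (iter_linear m lin).
have dX n : d (c ^+ n) = 0.
  exact: (subalgebraX n subalgebra_ker (dds : [set a | d a = 0] c)).
have dmc : d (m`!%:R * c ^+ m) = 0 by rewrite lnd_mul_ker ?lnd_natr // dX mulr0.
have [n Bn] : exists n, B (c ^+ n * (m`!%:R * c ^+ m * a - am * s ^+ m)).
  apply: IHm; rewrite defDm linearB -defDm /= iter_mul_ker //.
  by rewrite (iter_mul_ker _ _ da) iter_slice_exp // -/am -/c mulrC subrr.
exists (n + m)%N; have Bnm : B (c ^+ n * (am * s ^+ m)).
  exact: BM (kerB _ (dX n)) (BM _ _ (kerB _ da) (subalgebraX m algB Bs)).
have B0 : B 0 by apply: kerB; rewrite defD linear0.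
have -> : c ^+ (n + m) * a = (m`!%:R : k)^-1 *:
    (1 *: (c ^+ n * (m`!%:R * c ^+ m * a - am * s ^+ m)) + c ^+ n * (am * s ^+ m)) + 0.
  apply: (@scalerI _ _ (m`!%:R : k)); first exact: fact_neq0.
  rewrite addr0 scalerA mulfV ?fact_neq0 // !scale1r scaler_nat -mulr_natl exprD.
  by ring.
exact: (BL _ _ _ (BL _ _ _ Bn Bnm) B0).
Qed.

(** The last but one nonzero iterate of d on b is a local slice. *)
Lemma ex_slice (B : set A) b : (forall a, B a -> B (d a)) -> B b -> d b != 0 ->
  exists s, [/\ B s, d s != 0 & d (d s) = 0].
Proof.
move=> stabB Bb db0; have [_ _ nil] := lnd.
have exn : exists n, iter n d b == 0 by have [n /eqP] := nil b; exists n.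
case: (ex_minnP exn) => -[|[|n]] /eqP dnb minn.
- have [/linear_pack [D defD] _ _] := lnd; have b0 : b = 0 := dnb.
  by move: db0; rewrite b0 defD linear0 eqxx.
- by have e : d b = 0 := dnb; rewrite e eqxx in db0.
exists (iter n d b); split=> [||//].
  by elim: n {dnb minn} => //= n; apply: stabB.
by apply/eqP => e; have := minn n.+1; rewrite /= e eqxx ltnn => /(_ isT).
Qed.

End Slices.

(** * Nonconstant functions in the kernel *)

Section Kernel.
Variables (k : closedFieldType) (A : comAlgType k).
Hypothesis chark0 : [pchar k] =i pred0.

(** Over an algebraically closed field, p splits into linear factors. *)
Lemma horner_alg_prime (P : {pred A}) s (p : {poly k}) : prime_ideal P ->
  p != 0 -> horner_alg s p \in P -> exists r, s - r%:A \in P.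
Proof.
move=> [[P0 P1 Pl] Pp] p0.
have PM a u : u \in P -> a * u \in P.
  by move=> Pu; rewrite -[_ * _]addr0; apply: Pl.
have [rs ->] := closed_field_poly_normal p.
rewrite linearZ rmorph_prod /= => /Pp /orP [Pc|].
  case/negP: P1; rewrite -[1](@scale1r k) -(mulVf (_ : lead_coef p != 0)).
    by rewrite -scalerA -mulr_algl; apply: PM.
  by rewrite lead_coef_eq0.
elim: rs => [|r rs IHrs]; first by rewrite big_nil (negPf P1).
rewrite big_cons => /Pp /orP [|//].
by rewrite rmorphB /= horner_algX horner_algC => Pr; exists r.
Qed.

(** If the kernel were k, the localization at a slice s would give A = k[s], whose
    nonzero prime ideals are maximal: modulo an element s - r of such an ideal,
    every element of A is a constant. *)
Lemma ker_nonconstant (d : A -> A) b : locally_nilpotent_derivation A d ->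
  d b != 0 -> dimension_ge A 2 -> exists f, d f = 0 /\ forall c : k, f <> c%:A.
Proof.
move=> lnd db0 [P [primeP chainP]].
have [|const] := pselect (exists f, d f = 0 /\ forall c : k, f <> c%:A) => //.
have {}const f : d f = 0 -> exists c : k, f = c%:A.
  move=> df0; have [//|nc] := pselect (exists c : k, f = c%:A).
  by case: const; exists f; split=> // c fc; apply: nc; exists c.
have [s [_ ds0 dds]] := ex_slice lnd (B := setT) (fun _ _ => I) I db0.
have gen a : exists p, a = horner_alg s p.
  have algB : subalgebra [set a | exists p : {poly k}, a = horner_alg s p].
    split.
    - by exists 1; rewrite rmorph1.
    - by move=> t _ _ [p ->] [q ->]; exists (t *: p + q); rewrite linearD linearZ /= mulr_algl.
    - by move=> _ _ [p ->] [q ->]; exists (p * q); rewrite rmorphM.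
  have [||n [p]] := slice_localization chark0 lnd algB _ _ dds a.
  - by move=> f /const [c ->]; exists c%:P; rewrite horner_algC.
  - by exists 'X; rewrite horner_algX.
  have [c dsc] := const _ dds; rewrite dsc => eq_ca.
  have c0 : c != 0 by apply: contraNneq ds0 => c0; rewrite dsc c0 scale0r.
  exists (c ^- n *: p); rewrite linearZ /= -eq_ca exprZn expr1n !mulr_algl.
  by rewrite scalerA mulVf ?scale1r ?expf_neq0.
have [sub01 nsub01] := chainP 0%N isT; have [sub12 nsub12] := chainP 1%N isT.
have ex_notin (Q Q' : {pred A}) : ~ {subset Q <= Q'} -> exists2 a, a \in Q & a \notin Q'.
  move=> nsub; apply: contrapT => no; apply: nsub => a Qa.
  by apply/negPn/negP => Q'a; apply: no; exists a.
have [a1 P1a1 P0a1] := ex_notin _ _ nsub01.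
have [a2 P2a2 P1a2] := ex_notin _ _ nsub12.
have prime1 := primeP 1%N isT; have prime2 := primeP 2%N isT.
have [p1 a1E] := gen a1; have [p2 a2E] := gen a2.
have [r P1r] : exists r, s - r%:A \in P 1%N.
  apply: (horner_alg_prime prime1 (p := p1)); last by rewrite -a1E.
  apply: contraNneq P0a1 => p10; rewrite a1E p10 rmorph0.
  by have [[]] := primeP 0%N isT.
(* modulo s - r, every element of A is a constant *)
have [q p2E] : exists q, p2 = q * ('X - r%:P) + (p2.[r])%:P.
  have /factor_theorem [q e] : root (p2 - (p2.[r])%:P) r.
    by rewrite /root hornerD hornerN hornerC subrr.
  by exists q; rewrite -e subrK.
have a2E' : a2 = horner_alg s q * (s - r%:A) + (p2.[r])%:A.
  by rewrite a2E {1}p2E rmorphD rmorphM rmorphB /= horner_algX !horner_algC.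
have [[P1_0 _ P1l] _] := prime1; have [[_ P2_1 P2l] _] := prime2.
have c0 : p2.[r] != 0.
  apply: contraNneq P1a2 => c0; rewrite a2E' c0 scale0r.
  exact: P1l.
case/negP: P2_1.
have -> : 1 = ((p2.[r])^-1)%:A * (- horner_alg s q * (s - r%:A) + a2) + 0 :> A.
  by rewrite a2E' mulNr addKr addr0 mulr_algl scalerA mulVf // scale1r.
have P2_0 : 0 \in P 2%N by apply: sub12.
exact: P2l (P2l _ _ _ (sub12 _ P1r) P2a2) P2_0.
Qed.

End Kernel.

(** * Polynomial curves *)

Section PolynomialCurves.
Variables (k : closedFieldType) (A : comAlgType k).

(** A morphism from the affine line to the vector space A. *)
Definition polynomial_curve (c : k -> A) : Prop :=
  exists p : {poly A}, forall t, c t = p.[t%:A].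

Lemma polynomial_curve_cst a : polynomial_curve (fun=> a).
Proof. by exists a%:P => t; rewrite hornerC. Qed.

Lemma polynomial_curve_sum n (c : nat -> k -> A) :
  (forall i, polynomial_curve (c i)) ->
  polynomial_curve (fun t => \sum_(i < n) c i t).
Proof.
move=> /choice [p pE]; exists (\sum_(i < n) p i) => t.
by rewrite horner_sum; apply: eq_bigr => i _; rewrite pE.
Qed.

Lemma polynomial_curve_scale (c : k -> A) n :
  polynomial_curve c -> polynomial_curve (fun t => t ^+ n *: c t).
Proof.
case=> p pE; exists ('X^n * p) => t.
rewrite hornerM_comm; last exact: mulrC.
by rewrite hornerXn exprZn expr1n mulr_algl pE.
Qed.

Lemma polynomial_curveE (p : {poly A}) (t : k) :
  p.[t%:A] = \sum_(i < size p) t ^+ i *: p`_i.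
Proof.
by rewrite horner_coef; apply: eq_bigr => i _; rewrite exprZn expr1n mulr_algr.
Qed.

Lemma polynomial_curve_linear (L : k -> A -> A) (c : k -> A) :
  (forall t, linear (L t)) -> (forall a, polynomial_curve (L^~ a)) ->
  polynomial_curve c -> polynomial_curve (fun t => L t (c t)).
Proof.
move=> linL polL [p pE].
suff -> : (fun t => L t (c t)) = (fun t => \sum_(i < size p) t ^+ i *: L t p`_i).
  apply: (@polynomial_curve_sum _ (fun i t => t ^+ i *: L t p`_i)) => i.
  exact: polynomial_curve_scale.
apply: funext => t; rewrite pE polynomial_curveE.
have [D ->] := linear_pack (linL t); rewrite linear_sum.
by apply: eq_bigr => i _; rewrite linearZ.
Qed.

Lemma polynomial_curve_exp (d : A -> A) (c : k -> A) :
  locally_nilpotent_derivation A d -> polynomial_curve c ->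
  polynomial_curve (fun t => lnd_exp (fun a => t *: d a) (c t)).
Proof.
move=> lnd; have [lin _ nil] := lnd.
apply: (@polynomial_curve_linear (fun t => lnd_exp (fun a => t *: d a))) => [t|a].
  apply: lnd_exp_linear; have := replica_lnd lnd (lndA t lnd).
  by congr (locally_nilpotent_derivation A _); apply: funext => b; rewrite mulr_algl.
have [n na0] := nil a.
suff -> : (fun t => lnd_exp (fun a => t *: d a) a) =
    (fun t => \sum_(i < n) t ^+ i *: ((i`!%:R : k)^-1 *: iter i d a)).
  apply: (@polynomial_curve_sum _
    (fun i t => t ^+ i *: ((i`!%:R : k)^-1 *: iter i d a))) => i.
  apply: polynomial_curve_scale; exact: polynomial_curve_cst.
apply: funext => t; rewrite (lnd_expZ _ lin na0).
by apply: eq_bigr => i _; rewrite scalerA.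
Qed.

Lemma polynomial_curve_scalar (L : A -> k) (c : k -> A) :
  scalar L -> polynomial_curve c -> exists p : {poly k}, forall t, L (c t) = p.[t].
Proof.
move=> lin [p pE].
pose D := HB.pack_for {scalar A} L (GRing.isLinear.Build k A k *%R L lin).
exists (\poly_(i < size p) L p`_i) => t.
rewrite horner_poly pE polynomial_curveE -[L]/(D : A -> k) linear_sum.
by apply: eq_bigr => i _; rewrite linearZ /= mulrC.
Qed.

(** A polynomial in t that vanishes identically has a zero coefficient of t. *)
Lemma scalar_exp_derivative (L : A -> k) (d : A -> A) a : scalar L ->
  locally_nilpotent_derivation A d ->
  (forall t, L (lnd_exp (fun b => t *: d b) a) = 0) -> L (d a) = 0.
Proof.
move=> linL [lin _ nil] L0; have [n na0] := nil a.
have {}na0 : iter n.+2 d a = 0 by apply: iter_eq0 na0 _; rewrite // ltnW.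
pose D := HB.pack_for {scalar A} L (GRing.isLinear.Build k A k *%R L linL).
pose p := \poly_(i < n.+2) ((i`!%:R)^-1 * L (iter i d a)).
have p0 : p = 0.
  apply/eqP/negPn/negP => /closed_nonrootP [t /negP []].
  apply/eqP; rewrite -(L0 t) horner_poly (lnd_expZ _ lin na0) -[L]/(D : A -> k).
  by rewrite linear_sum; apply: eq_bigr => i _; rewrite linearZ /=; ring.
by have := congr1 (fun q : {poly k} => q`_1) p0; rewrite coef_poly coef0 /= invr1 mul1r.
Qed.

End PolynomialCurves.

(** * The group generated by the exponentials, and its irreducibility *)

Section Subgroups.
Variables (k : closedFieldType) (A : comAlgType k).

Lemma automorphism_subgroup : is_subgroup (automorphism A).
Proof.
split; first by [].
- by split; [|split|exists idfun].
- move=> g h [ling [g1 gM] bg] [linh [h1 hM] bh]; split.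
  + by move=> t a b /=; rewrite linh ling.
  + by split=> [|a b] /=; rewrite ?h1 ?g1 // hM gM.
  + exact: bij_comp.
move=> g g' [/linear_pack ling [g1 gM] bg] gK g'K; have [D defD] := ling.
split; last by exists g.
- move=> t a b; apply: (can_inj gK); rewrite g'K defD linearP -defD.
  by rewrite /= !g'K.
- by split=> [|a b]; apply: (can_inj gK); rewrite g'K ?g1 // gM !g'K.
Qed.

Lemma SAut_automorphism : SAut A `<=` automorphism A.
Proof.
apply: smallest_sub; first exact: automorphism_subgroup.
by move=> g [_ [phi [autphi _ _ _ ->]] [t _ <-]].
Qed.

Definition ginv (g : A -> A) : A -> A :=
  match pselect (exists g', cancel g g' /\ cancel g' g) with
  | left ex => sval (cid ex)
  | right _ => idfun
  end.

End Subgroups.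

Section Action.
Variables (k : closedFieldType) (A : comAlgType k).
Hypothesis chark0 : [pchar k] =i pred0.
Variable N : set (A -> A).
Hypothesis lndN : N `<=` locally_nilpotent_derivation A.
Hypothesis satN : saturated N.
Notation G := (group_generated_by_lnds N).
Hypothesis autG : G `<=` automorphism A.

Lemma group_id : G idfun.
Proof. by move=> H [[_ H1 _ _] _]. Qed.

Lemma group_comp g h : G g -> G h -> G (g \o h).
Proof.
by move=> Gg Gh H [subH genH]; have [_ _ HM _] := subH; apply: HM; [apply: Gg|apply: Gh].
Qed.

Lemma group_inv g g' : G g -> cancel g g' -> cancel g' g -> G g'.
Proof.
move=> Gg gK g'K H [subH genH]; have [_ _ _ HV] := subH.
by apply: HV gK g'K; apply: Gg.
Qed.

Lemma group_ginv g : G g -> [/\ G (ginv g), cancel g (ginv g) & cancel (ginv g) g].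
Proof.
move=> Gg; have [_ _ [g' gK g'K]] := autG Gg.
have [gK1 gK2] : cancel g (ginv g) /\ cancel (ginv g) g.
  rewrite /ginv; case: pselect => [ex|no]; first exact: svalP (cid ex).
  by case: no; exists g'.
by split=> //; apply: group_inv Gg _ _.
Qed.

Lemma ginv_uniq g g' : G g -> cancel g g' -> ginv g = g'.
Proof.
move=> Gg gK; have [_ _ g'K] := group_ginv Gg.
by apply: funext => a; rewrite -{2}[a]g'K gK.
Qed.

Lemma group_morphism g : G g -> exists h : {lrmorphism A -> A}, g = h.
Proof. by move=> /autG [lin mor _]; apply: morphism_pack. Qed.

Lemma lnds_scale d (t : k) : N d -> N (fun a => t *: d a).
Proof.
move=> Nd; have := satN.2 d t%:A Nd (lndA t (lndN Nd)).
by congr N; apply: funext => a; rewrite mulr_algl.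
Qed.

Lemma group_exp d : N d -> G (lnd_exp d).
Proof.
move=> Nd H [_ genH]; apply: genH; exists d => //; exists 1.
by congr lnd_exp; apply: funext => a; rewrite scale1r.
Qed.

Lemma group_expZ d t : N d -> G (lnd_exp (fun a => t *: d a)).
Proof. by move=> Nd; exact: group_exp (lnds_scale t Nd). Qed.

Lemma expZ_inv d t : N d ->
  ginv (lnd_exp (fun a => t *: d a)) = lnd_exp (fun a => (- t) *: d a).
Proof.
move=> Nd; apply: ginv_uniq (group_expZ t Nd) _.
have -> : (fun a => (- t) *: d a) = (fun a => -1 *: (t *: d a)).
  by apply: funext => a; rewrite scalerA mulN1r.
by have := lnd_expN chark0 (lndN (lnds_scale t Nd)).
Qed.

(** Since the inverse of exp d is exp (- d), and N is closed under scaling, G is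
    generated by the exponentials of N as a monoid. *)
Lemma group_ind (P : (A -> A) -> Prop) :
  P idfun -> (forall d, N d -> P (lnd_exp d)) ->
  (forall g h, G g -> G h -> P g -> P h -> P (g \o h)) ->
  forall g, G g -> P g.
Proof.
move=> P1 Pexp PM.
pose H g := [/\ G g, P g & P (ginv g)].
suff GH : G `<=` H by move=> g /GH [].
have HV g : H g -> H (ginv g).
  move=> [Gg Pg Pg']; have [Gg' gK g'K] := group_ginv Gg.
  by split; rewrite ?(ginv_uniq Gg' g'K).
have invM g h : G g -> G h -> ginv (g \o h) = ginv h \o ginv g.
  move=> Gg Gh; have [_ gK _] := group_ginv Gg; have [_ hK _] := group_ginv Gh.
  by apply: ginv_uniq; [apply: group_comp|apply: can_comp].
apply: smallest_sub.
  split=> [g [/autG]//| |g h [Gg Pg Pg'] [Gh Ph Ph']|g g' Hg gK g'K].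
  - by split; rewrite ?(@ginv_uniq _ idfun) //; apply: group_id.
  - split; [exact: group_comp|exact: PM|rewrite invM //].
    by have [Gg' _ _] := group_ginv Gg; have [Gh' _ _] := group_ginv Gh; apply: PM.
  - by have [Gg _ _] := Hg; rewrite -(ginv_uniq Gg gK); apply: HV.
move=> _ [d Nd [t ->]]; split; first exact: group_expZ.
  exact/Pexp/lnds_scale.
by rewrite expZ_inv //; apply/Pexp/lnds_scale.
Qed.

Lemma lnd_exp1 d : lnd_exp (fun a => (1 : k) *: d a) = lnd_exp d :> (A -> A).
Proof. by congr lnd_exp; apply: funext => a; rewrite scale1r. Qed.

Lemma lnd_exp0 d : N d -> lnd_exp (fun a => (0 : k) *: d a) = idfun.
Proof.
move=> Nd; apply: funext => a; apply: lnd_exp_killed; last by rewrite scale0r.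
exact/lndN/lnds_scale.
Qed.

(** G carries no structure of a variety, but the exponentials provide it with
    many affine lines; a function is regular when it is polynomial along each of
    them. This is enough for G to behave as an irreducible variety. *)
Definition regular (F : (A -> A) -> k) : Prop :=
  forall g h d, G g -> G h -> N d -> exists p : {poly k},
    forall t, F (g \o lnd_exp (fun a => t *: d a) \o h) = p.[t].

Lemma regularM F1 F2 : regular F1 -> regular F2 -> regular (fun g => F1 g * F2 g).
Proof.
move=> reg1 reg2 g h d Gg Gh Nd.
have [p1 p1E] := reg1 g h d Gg Gh Nd; have [p2 p2E] := reg2 g h d Gg Gh Nd.
by exists (p1 * p2) => t; rewrite hornerM p1E p2E.
Qed.

Lemma regular_scalar (L : A -> k) a : scalar L -> regular (fun g => L (g a)).
Proof.
move=> lin g h d Gg Gh Nd.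
apply: (@polynomial_curve_scalar _ _ L (fun t => g (lnd_exp (fun a => t *: d a) (h a)))) => //.
have [ling _ _] := autG Gg.
apply: (@polynomial_curve_linear _ _ (fun=> g)) => // [b|].
  exact: polynomial_curve_cst.
by apply: polynomial_curve_exp (lndN Nd) _; apply: polynomial_curve_cst.
Qed.

(** The inverse of g exp(t d) h contains exp(- t d), which is again polynomial
    in t. *)
Lemma regular_conj (L : A -> k) (u : A -> A) a : scalar L -> linear u ->
  regular (fun g => L (g (u (ginv g a)))).
Proof.
move=> linL linu g h d Gg Gh Nd.
have cst (v : A -> A) c : linear v -> polynomial_curve c ->
    polynomial_curve (fun t : k => v (c t)).
  move=> linv; apply: (@polynomial_curve_linear _ _ (fun=> v)) => // b.
  exact: polynomial_curve_cst.
have [Gh' hK _] := group_ginv Gh; have [Gg' gK _] := group_ginv Gg.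
have [ling _ _] := autG Gg; have [linh _ _] := autG Gh.
have [linh' _ _] := autG Gh'.
have [|p pE] := @polynomial_curve_scalar _ _ L
  (fun t => g (lnd_exp (fun a => t *: d a) (h (u (ginv h
              (lnd_exp (fun a => t *: (-1 *: d a)) (ginv g a))))))) linL.
  apply: (cst g) => //; apply: polynomial_curve_exp (lndN Nd) _ => //.
  apply: (cst h) => //; apply: (cst u) => //; apply: (cst (ginv h)) => //.
  apply: polynomial_curve_exp => //; first exact/lndN/lnds_scale.
  exact: polynomial_curve_cst.
exists p => t; rewrite -pE.
rewrite (@ginv_uniq _ (ginv h \o lnd_exp (fun a => t *: (-1 *: d a)) \o ginv g)) //.
  exact: group_comp (group_comp Gg (group_expZ t Nd)) Gh.
have [_ eK _] := group_ginv (group_expZ t Nd); move: eK; rewrite expZ_inv //.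
have -> : (fun a => (- t) *: d a) = (fun a => t *: (-1 *: d a)).
  by apply: funext => b; rewrite scalerA mulrN1.
by move=> eK b /=; rewrite gK eK hK.
Qed.

Lemma regular_translate F h : regular F -> G h -> regular (fun g => F (g \o h)).
Proof. by move=> reg Gh g h' d Gg Gh'; apply: (reg g (h' \o h)) => //; apply: group_comp. Qed.

(** Two elements of G are joined by a chain of lines t |-> g exp(t d). Along one
    line, two regular functions are polynomials in t, and nonzero polynomials
    over an infinite field are nonzero at a common point. The claim below is stated
    for all F1 and F2 so that, in a chain, F2 can be translated by the part of
    the chain that comes later. *)
Lemma group_irreducible F1 F2 g1 g2 : regular F1 -> regular F2 ->
  G g1 -> F1 g1 != 0 -> G g2 -> F2 g2 != 0 ->
  exists g, [/\ G g, F1 g != 0 & F2 g != 0].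
Proof.
move=> reg1 reg2 Gg1 F1g1 Gg2 F2g2.
have [Gg1' g1K g1K'] := group_ginv Gg1.
suff /(_ (ginv g1 \o g2)) claim : forall w, G w -> forall F1 F2 g,
    regular F1 -> regular F2 -> G g -> F1 g != 0 -> F2 (g \o w) != 0 ->
    exists g', [/\ G g', F1 g' != 0 & F2 g' != 0].
  apply: claim F1g1 _ => //; first exact: group_comp.
  suff -> : g1 \o (ginv g1 \o g2) = g2 by [].
  by apply: funext => a /=; rewrite g1K'.
apply: group_ind => {g1 g2 Gg1 Gg2 F1g1 F2g2 Gg1' g1K g1K' F1 F2 reg1 reg2}.
- by move=> F1 F2 g _ _ Gg F1g F2g; exists g.
- move=> d Nd F1 F2 g reg1 reg2 Gg F1g F2g.
  have [p1 p1E] := reg1 g idfun d Gg group_id Nd.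
  have [p2 p2E] := reg2 g idfun d Gg group_id Nd.
  have p1n0 : p1 != 0.
    by apply: contraNneq F1g => p10; have := p1E 0; rewrite lnd_exp0 // p10 horner0 => ->.
  have p2n0 : p2 != 0.
    by apply: contraNneq F2g => p20; have := p2E 1; rewrite lnd_exp1 p20 horner0 => ->.
  have /closed_nonrootP [t] : p1 * p2 != 0 by rewrite mulf_neq0.
  rewrite rootM negb_or => /andP [r1 r2].
  exists (g \o lnd_exp (fun a => t *: d a) \o idfun).
  rewrite p1E p2E; split=> //.
  by apply: (group_comp (group_comp Gg _) group_id); apply: group_expZ.
move=> w1 w2 Gw1 Gw2 IH1 IH2 F1 F2 g reg1 reg2 Gg F1g F2g.
have [g' [Gg' F1g' F2g']] :=
  IH1 _ _ _ reg1 (regular_translate reg2 Gw2) Gg F1g F2g.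
exact: IH2 reg1 reg2 Gg' F1g' F2g'.
Qed.

(** Finitely many regular functions, none of them zero, are all nonzero at a
    generic element of G; F0 accumulates the product of those already treated. *)
Lemma group_generic (I : finType) (F : I -> (A -> A) -> k) F0 :
  regular F0 -> (exists g, G g /\ F0 g != 0) ->
  (forall i, regular (F i)) -> (forall i, exists g, G g /\ F i g != 0) ->
  exists g, [/\ G g, F0 g != 0 & forall i, F i g != 0].
Proof.
move=> reg0 ex0 regF exF.
suff [g [Gg F0g Fg]] : exists g, [/\ G g, F0 g != 0
    & forall i, i \in enum I -> F i g != 0].
  by exists g; split=> // i; apply: Fg; rewrite mem_enum.
elim: (enum I) F0 reg0 ex0 => [|i r IHr] F0 reg0 [g0 [Gg0 F0g0]].
  by exists g0; split.
have [gi [Ggi Figi]] := exF i.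
have [g [Gg F0g Fig]] := group_irreducible reg0 (regF i) Gg0 F0g0 Ggi Figi.
have [||g' [Gg' /=]] := IHr (fun g => F0 g * F i g).
- exact: regularM.
- by exists g; split=> //; rewrite mulf_neq0.
rewrite mulf_eq0 negb_or => /andP [F0g' Fig'] rg'.
exists g'; split=> // j; rewrite inE => /orP [/eqP->//|]; exact: rg'.
Qed.

End Action.

(** * Transitivity of stabilisers on the open orbit *)

Section Transitivity.
Variables (k : closedFieldType) (A : comAlgType k).
Hypothesis chark0 : [pchar k] =i pred0.
Hypothesis domA : GRing.integral_domain_axiom A.
Variable N : set (A -> A).
Hypothesis lndN : N `<=` locally_nilpotent_derivation A.
Hypothesis satN : saturated N.
Notation G := (group_generated_by_lnds N).
Hypothesis autG : G `<=` automorphism A.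

Lemma lnd_exp_conj g e : G g -> N e ->
  N (g \o e \o ginv g) /\ lnd_exp (g \o e \o ginv g) = g \o lnd_exp e \o ginv g.
Proof.
move=> Gg Ne; have [_ gK g'K] := group_ginv autG Gg.
have Nge : N (g \o e \o ginv g) by apply: satN.1 => //.
split=> //; apply: funext => a /=.
have [lin _ nil] := lndN Ne; have [linge _ _] := lndN Nge.
have [n na0] := nil (ginv g a).
have iterE i : iter i (g \o e \o ginv g) a = g (iter i e (ginv g a)).
  by elim: i => [|i IHi]; rewrite ?g'K //= IHi /= gK.
have [h defg] := group_morphism autG Gg.
rewrite (@lnd_expE _ _ _ _ n) //; last by rewrite iterE na0 defg linear0.
rewrite (lnd_expE lin na0) [in RHS]defg linear_sum; apply: eq_bigr => i _.
by rewrite linearZ /= iterE -defg.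
Qed.

Lemma points_comp x g : points A x -> G g -> points A (x \o g).
Proof.
move=> /point_pack [y ->] /(group_morphism autG) [h ->]; split=> [t a b|].
  by rewrite /= !linearP.
by split=> [|a b]; rewrite /= ?rmorph1 ?rmorphM.
Qed.

(** At the point x, the flow of the replica f e is that of e with time f(x). *)
Lemma point_replica x f e a : points A x -> N e -> e f = 0 ->
  x (lnd_exp (fun b => f * e b) a) = x (lnd_exp (fun b => x f *: e b) a).
Proof.
move=> /point_pack [y ->] Ne ef0; have [lin leib nil] := lndN Ne.
have [n na0] := nil a.
have [linf _ _] := replica_lnd (lndN Ne) ef0.
rewrite (lnd_expZ _ lin na0) (@lnd_expE _ _ _ _ n) //; last first.
  by rewrite iter_replica // na0 mulr0.
rewrite !linear_sum; apply: eq_bigr => i _.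
by rewrite !linearZ /= iter_replica // rmorphM rmorphXn mulrA [_^-1 * _]mulrC.
Qed.

(** The orbit relation of the pointwise stabiliser of the family Z in G. *)
Definition fixing_orbit (I : finType) (Z : I -> A -> k) (x y : A -> k) : Prop :=
  exists h, [/\ G h, forall i, Z i \o h = Z i & x \o h = y].

Lemma fixing_orbit_refl (I : finType) (Z : I -> A -> k) x : fixing_orbit Z x x.
Proof. by exists idfun; split=> //; apply: group_id. Qed.

Lemma fixing_orbit_sym (I : finType) (Z : I -> A -> k) x y :
  fixing_orbit Z x y -> fixing_orbit Z y x.
Proof.
move=> [h [Gh Zh <-]]; have [Gh' _ h'K] := group_ginv autG Gh.
exists (ginv h); split=> // [i|]; apply: funext => a /=; last by rewrite h'K.
by rewrite -{1}(Zh i) /= h'K.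
Qed.

Lemma fixing_orbit_trans (I : finType) (Z : I -> A -> k) x y z :
  fixing_orbit Z x y -> fixing_orbit Z y z -> fixing_orbit Z x z.
Proof.
move=> [g [Gg Zg <-]] [h [Gh Zh <-]].
exists (g \o h); split=> // [|i]; first exact: group_comp.
by rewrite -{2}(Zh i) -{2}(Zg i).
Qed.

(** The exponential of the replica (f / f(p)) e moves p as exp e does, and does
    not move the points of Z. *)
Lemma fixing_orbit_exp (I : finType) (Z : I -> A -> k) p e f :
  (forall i, points A (Z i)) -> points A p -> N e -> e f = 0 ->
  (forall i, Z i f = 0) -> p f != 0 -> fixing_orbit Z p (p \o lnd_exp e).
Proof.
move=> ptZ ptp Ne ef0 Zf0 pf0; have lnd := lndN Ne.
pose f' := (p f)^-1%:A * f.
have ef'0 : e f' = 0 by rewrite lnd_mul_ker ?ef0 ?mulr0 // lndA.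
exists (lnd_exp (fun b => f' * e b)); split.
- exact: group_exp (satN.2 _ _ Ne ef'0).
- move=> i; apply: funext => a /=; rewrite point_replica //.
  have [y yE] := point_pack (ptZ i).
  suff -> : Z i f' = 0 by rewrite (lnd_exp0 lndN satN).
  by rewrite yE rmorphM /= -yE Zf0 mulr0.
apply: funext => a /=; rewrite point_replica //.
have [y yE] := point_pack ptp.
suff -> : p f' = 1 by rewrite lnd_exp1.
by rewrite yE rmorphM /= linearZ /= rmorph1 mulr1 -yE mulVf.
Qed.

Variable (x0 : A -> k).
Hypothesis ptx0 : points A x0.
Notation O := (point_orbit G x0).
Hypothesis denseO : forall a, a != 0 -> exists2 x, O x & x a != 0.

Lemma orbit_points x : O x -> points A x.
Proof. by move=> [g Gg <-]; apply: points_comp. Qed.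

Lemma orbit_comp (x : A -> k) g : O x -> G g -> O (x \o g).
Proof. by move=> [h Gh <-] Gg; exists (h \o g) => //; apply: group_comp. Qed.

Lemma orbit_transitive (x y : A -> k) : O x -> O y -> exists2 g : A -> A, G g & x \o g = y.
Proof.
move=> [g Gg <-] [h Gh <-]; have [Gg' gK g'K] := group_ginv autG Gg.
exists (ginv g \o h); first exact: group_comp.
by apply: funext => a /=; rewrite g'K.
Qed.

Lemma orbit_dense (x : A -> k) a : O x -> a != 0 -> exists2 g : A -> A, G g & x (g a) != 0.
Proof.
move=> Ox /denseO [y Oy ya]; have [g Gg gE] := orbit_transitive Ox Oy.
by exists g => //; rewrite -gE in ya.
Qed.

Lemma comp_inj (x y : A -> k) g : G g -> x \o g = y \o g -> x = y.
Proof.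
move=> Gg e; have [_ _ g'K] := group_ginv autG Gg; apply: funext => a.
by have := congr1 (fun u => u (ginv g a)) e; rewrite /= g'K.
Qed.

Hypothesis dimA : dimension_ge A 2.

(** Let B be the algebra of the functions a such that g a takes the same value at
    p and q for all g in G. If the kernel of e never separated p and q, then B
    would contain it. Moreover B is stable under G, hence under N, as one sees by
    differentiating the flows of N.
    
    If e does not vanish on B, then B contains a local slice of e, so that B and A
    agree after inverting some c in B; moving p and q to where c does not vanish,
    one gets p = q.
    
    Otherwise B is the kernel of e. If some d in N does not vanish on B, then B
    contains a slice s of d; for f in the kernel of d, the replica f d maps s to
    f (d s), which therefore lies in B. So the kernel of d is contained in that of
    e, and localizing at s gives e = 0. If all of N vanishes on B, then G fixes B,
    and the elements of B are constant on the dense orbit: this contradicts the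
    existence of nonconstant elements in the kernel of e. *)
Lemma separation e b (p q : A -> k) : N e -> e b != 0 -> O p -> O q -> p <> q ->
  exists f, e f = 0 /\ exists g, G g /\ p (g f) != q (g f).
Proof.
move=> Ne eb0 Op Oq neq_pq; apply: contrapT => nosep.
pose B : set A := [set a | forall g, G g -> p (g a) = q (g a)].
have kerB f : e f = 0 -> B f.
  move=> ef0 g Gg; apply/eqP/negPn/negP => neq; apply: nosep.
  by exists f; split=> //; exists g.
have [yp pE] := point_pack (orbit_points Op).
have [yq qE] := point_pack (orbit_points Oq).
have algB : subalgebra B.
  split=> [g /(group_morphism autG) [h ->]|t a c Ba Bc g Gg|a c Ba Bc g Gg].
  - by rewrite pE qE !rmorph1.
  - have [h hE] := group_morphism autG Gg.
    by rewrite pE qE hE !linearP /= -hE -pE -qE Ba // Bc.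
  - have [h hE] := group_morphism autG Gg.
    by rewrite pE qE hE !rmorphM /= -hE -pE -qE Ba // Bc.
have stabB d : N d -> forall a, B a -> B (d a).
  move=> Nd a Ba g Gg.
  have linL : scalar (fun c => p (g c) - q (g c)).
    have [h hE] := group_morphism autG Gg.
    by move=> t u v; rewrite pE qE hE !linearP /=; ring.
  apply/eqP; rewrite -subr_eq0; apply/eqP.
  apply: (scalar_exp_derivative (a := a) linL (lndN Nd)) => t.
  have Gexp : G (g \o lnd_exp (fun b => t *: d b)).
    by apply: group_comp Gg _; apply: group_expZ.
  by have /= -> := Ba _ Gexp; rewrite subrr.
(* either e is nonzero on B, or B is the kernel of e *)
have [[s0 [Bs0 es0]]|killB] := pselect (exists s, B s /\ e s != 0).
  have [s [Bs c0 ec0]] := ex_slice (lndN Ne) (stabB e Ne) Bs0 es0.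
  have [g Gg pgc] := orbit_dense Op c0.
  apply: neq_pq; apply: (comp_inj Gg); apply: funext => a /=.
  have [n Bn] := slice_localization chark0 (lndN Ne) algB kerB Bs ec0 a.
  have [h hE] := group_morphism autG Gg.
  have qgc : q (g (e s)) = p (g (e s)) by rewrite (kerB _ ec0).
  have := Bn g Gg; rewrite pE qE hE !rmorphM !rmorphXn /= -hE -pE -qE qgc.
  by apply: mulfI; rewrite expf_neq0.
have {}killB c : B c -> e c = 0.
  by move=> Bc; apply/eqP/negPn/negP => ec; apply: killB; exists c.
(* either some element of N is nonzero on B, or all of them vanish on B *)
have [[d [s0 [Nd Bs0 ds0]]]|killN] := pselect (exists d s, [/\ N d, B s & d s != 0]).
  have [s [Bs c0 dc0]] := ex_slice (lndN Nd) (stabB d Nd) Bs0 ds0.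
  have ec0 : e (d s) = 0 by apply: killB; apply: stabB.
  have ker_sub f : d f = 0 -> e f = 0.
    move=> df0; apply: (domain_mulfI domA c0).
    rewrite -(lnd_mul_ker (lndN Ne)) //; apply: killB; rewrite mulrC.
    by apply: (stabB (fun a => f * d a)) => //; apply: satN.2.
  have [n] := slice_localization chark0 (lndN Nd) (subalgebra_ker (lndN Ne))
    ker_sub (killB _ Bs) dc0 b.
  have eX : e (d s ^+ n) = 0.
    exact: (subalgebraX n (subalgebra_ker (lndN Ne)) (ec0 : [set a | e a = 0] _)).
  rewrite /= (lnd_mul_ker (lndN Ne)) // => /(domain_mulfI domA).
  by move/(_ (domain_expf_neq0 domA n c0)) => eb; rewrite eb eqxx in eb0.
have fixB g : G g -> forall c, B c -> g c = c.
  move=> Gg; elim/(group_ind chark0 lndN satN autG): g / Gg => //.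
    move=> d Nd c Bc; apply: lnd_exp_killed (lndN Nd) _.
    by apply/eqP/negPn/negP => dc; apply: killN; exists d, c.
  by move=> g h _ _ IHg IHh c Bc /=; rewrite IHh // IHg.
have [f [ef0 ncf]] := ker_nonconstant chark0 (lndN Ne) eb0 dimA.
have [_ BL _] := algB.
apply: (ncf (p f)); apply/eqP; rewrite -subr_eq0; apply/negPn/negP => fc0.
have [g Gg] := orbit_dense Op fc0; rewrite fixB //.
  by rewrite pE rmorphB /= linearZ /= rmorph1 mulr1 subrr eqxx.
rewrite addrC -scaleNr; apply: BL; first exact/kerB/lnd1/lndN.
exact: kerB.
Qed.

(** Since the orbit of p under G is dense, b does not vanish somewhere on it; one
    follows a path of exponentials of N from p to such a place. A step exp e of
    the path may not be available in the stabiliser of W, because the kernel of e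
    need not separate p from W. It is replaced by the step g exp e g^-1 for a
    generic g in G: the kernel of g e g^-1 separates p from W, and b is still
    nonzero at the end of the path, since it is for g = 1. *)
Lemma fixing_orbit_dense (I : finType) (W : I -> A -> k) p b :
  (forall i, O (W i)) -> O p -> (forall i, W i <> p) -> b != 0 ->
  exists h, [/\ G h, forall i, W i \o h = W i & p (h b) != 0].
Proof.
move=> OW Op Wp b0; have [v Gv pvb] := orbit_dense Op b0.
elim/(group_ind chark0 lndN satN autG): v / Gv p b Op Wp pvb {b0}.
- by move=> p b _ _ pb; exists idfun; split=> //; apply: group_id.
- move=> e Ne p b Op Wp peb.
  have [[c ec0]|e0] := pselect (exists c, e c != 0); last first.
    exists idfun; split=> //; first exact: group_id.
    rewrite lnd_exp_killed in peb => //; first exact: lndN.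
    by apply/eqP/negPn/negP => eb; apply: e0; exists b.
  have /choice [f fE] : forall i, exists f, e f = 0 /\
      exists g, G g /\ p (g f) != W i (g f).
    by move=> i; apply: separation ec0 _ _ _ => // pW; case: (Wp i).
  have [yp pE] := point_pack (orbit_points Op).
  have [||||g [Gg F0g Fg]] := group_generic (F := fun i g => p (g (f i)) - W i (g (f i)))
    (F0 := fun g => p (g (lnd_exp e (ginv g b)))) chark0 lndN satN autG.
  - apply: (regular_conj chark0 lndN satN autG); first by have [] := orbit_points Op.
    exact/lnd_exp_linear/lndN.
  - exists idfun; split; first exact: group_id.
    by rewrite (ginv_uniq autG (@group_id _ _ N) (g' := idfun)).
  - move=> i; apply: (regular_scalar lndN autG (L := fun a => p a - W i a)).
    have [yW WE] := point_pack (orbit_points (OW i)).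
    by move=> t u v; rewrite pE WE !linearP /=; ring.
  - by move=> i; have [_ [g [Gg neq]]] := fE i; exists g; rewrite subr_eq0.
  have [Nge expge] := lnd_exp_conj Gg Ne; have [_ gK _] := group_ginv autG Gg.
  (* f' vanishes on W, does not vanish at p, and is killed by g e g^-1 *)
  pose f' := \prod_i (g (f i) - (W i (g (f i)))%:A).
  have [||||||h [Gh Wh ph]] := @fixing_orbit_exp _ W p (g \o e \o ginv g) f'.
  - by move=> i; apply: orbit_points.
  - exact: orbit_points.
  - exact: Nge.
  - have [K1 KL KM] := subalgebra_ker (lndN Nge).
    apply: (big_ind (fun a => (g \o e \o ginv g) a = 0)) => // i _.
    rewrite addrC -scaleNr; apply: KL => //=.
    by rewrite gK (fE i).1; have [h ->] := group_morphism autG Gg; rewrite linear0.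
  - move=> i; have [y yE] := point_pack (orbit_points (OW i)).
    rewrite /f' (bigD1 i) //= yE rmorphM rmorphB /= linearZ /= rmorph1 mulr1 -yE.
    by rewrite subrr mul0r.
  - rewrite pE rmorph_prod; apply/prodf_neq0 => i _.
    by rewrite rmorphB /= linearZ /= rmorph1 mulr1 -pE.
  exists h; split=> //.
  by move: F0g; rewrite -[p (h b)]/((p \o h) b) ph expge.
move=> v1 v2 _ _ IH1 IH2 p b Op Wp pb.
have [h1 [Gh1 Wh1 ph1]] := IH1 p (v2 b) Op Wp pb.
have [|i eW|//|h2 [Gh2 Wh2 ph2]] := IH2 (p \o h1) b.
- exact: orbit_comp.
- by apply: (Wp i); apply: (comp_inj Gh1); rewrite Wh1.
exists (h1 \o h2); split=> // [|i]; first exact: group_comp.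
by rewrite -{2}(Wh2 i) -{2}(Wh1 i).
Qed.

(** For h = exp e it is enough to take for a a nonzero element of the kernel of e
    that vanishes on Z, namely a product of the f - f(Z i) for a nonconstant f. *)
Lemma fixing_orbit_generic (I : finType) (Z : I -> A -> k) h :
  (forall i, points A (Z i)) -> G h ->
  exists2 a, a != 0 & forall p, points A p -> p a != 0 -> fixing_orbit Z p (p \o h).
Proof.
move=> ptZ Gh; elim/(group_ind chark0 lndN satN autG): h / Gh.
- by exists 1; rewrite ?oner_neq0 // => p _ _; apply: fixing_orbit_refl.
- move=> e Ne; have [[b eb0]|e0] := pselect (exists b, e b != 0); last first.
    exists 1; rewrite ?oner_neq0 // => p _ _.
    suff -> : lnd_exp e = idfun by apply: fixing_orbit_refl.
    apply: funext => a; apply: lnd_exp_killed (lndN Ne) _.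
    by apply/eqP/negPn/negP => ea; apply: e0; exists a.
  have [f [ef0 ncf]] := ker_nonconstant chark0 (lndN Ne) eb0 dimA.
  exists (\prod_i (f - (Z i f)%:A)).
    apply: (big_ind (fun a => a != 0)) => [|a c|i _]; first exact: oner_neq0.
      exact: domain_mulf_neq0.
    by rewrite subr_eq0; apply/eqP/ncf.
  move=> p ptp pf; apply: fixing_orbit_exp pf => //.
    have [K1 KL KM] := subalgebra_ker (lndN Ne).
    apply: (big_ind (fun a => e a = 0)) => // i _.
    by rewrite addrC -scaleNr; apply: KL.
  move=> i; have [y yE] := point_pack (ptZ i).
  by rewrite (bigD1 i) //= yE rmorphM rmorphB /= linearZ /= rmorph1 mulr1 subrr mul0r.
move=> g h Gg Gh [a a0 aE] [c c0 cE].
exists (a * g c).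
  apply: domain_mulf_neq0 => //; have [_ gK _] := group_ginv autG Gg.
  apply: contraNneq c0 => gc0; apply/eqP/(can_inj gK); rewrite gc0.
  by have [g' ->] := group_morphism autG Gg; rewrite linear0.
move=> p ptp; have [y pE] := point_pack ptp.
rewrite {1}pE rmorphM /= mulf_eq0 negb_or -pE => /andP [pa pgc].
apply: fixing_orbit_trans (aE p ptp pa) _.
exact: (cE (p \o g) (points_comp ptp Gg)).
Qed.

(** Write y = x g. With W the union of Z and Z g^-1, some h in the stabiliser of W
    brings x to a point x h which is generic in the sense of the previous lemma for
    Z and g. Then x, x h and x h g lie in one orbit of the stabiliser of Z, and so
    do x h g = y (g^-1 h g) and y, since g^-1 h g fixes Z. *)
Theorem fixing_orbit_all (I : finType) (Z : I -> A -> k) x y :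
  (forall i, O (Z i)) -> O x -> O y -> (forall i, Z i <> x) -> (forall i, Z i <> y) ->
  fixing_orbit Z x y.
Proof.
move=> OZ Ox Oy Zx Zy; have [g Gg xg] := orbit_transitive Ox Oy.
have [Gg' gK g'K] := group_ginv autG Gg.
have [a a0 aE] := fixing_orbit_generic (fun i => orbit_points (OZ i)) Gg.
pose W (j : I + I) := match j with inl i => Z i | inr i => Z i \o ginv g end.
have [||h [Gh Wh xha]] := @fixing_orbit_dense _ W x a _ Ox _ a0.
- by case=> i //=; apply: orbit_comp.
- case=> i //= eZ; apply: (Zy i); rewrite -xg -eZ.
  by apply: funext => c /=; rewrite gK.
have xh : fixing_orbit Z x (x \o h).
  by exists h; split=> // i; apply: (Wh (inl i)).
apply: fixing_orbit_trans xh _.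
have xhg := aE (x \o h) (points_comp (orbit_points Ox) Gh) xha.
apply: fixing_orbit_trans xhg _; apply: fixing_orbit_sym.
exists (ginv g \o h \o g); split.
- exact: group_comp (group_comp Gg' Gh) Gg.
- move=> i; rewrite -[LHS]/((Z i \o ginv g \o h) \o g) (Wh (inr i)).
  by apply: funext => c /=; rewrite gK.
by rewrite -xg; apply: funext => c /=; rewrite g'K.
Qed.

(** All points but the first are moved to their targets by induction; then the
    first one is moved by an element that fixes those targets. *)
Theorem orbit_infinitely_transitive : infinitely_transitive G O.
Proof.
move=> m _; elim: m => [|m IHm] x y Ox Oy injx injy.
  by exists idfun => [|[]//]; apply: group_id.
have [g Gg xg] := IHm (fun i => x (lift ord0 i)) (fun i => y (lift ord0 i))
  (fun i => Ox _) (fun i => Oy _) (fun i j e => lift_inj (injx _ _ e))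
  (fun i j e => lift_inj (injy _ _ e)).
have [|||i|i|h [Gh Zh xh]] := @fixing_orbit_all _ (fun i => y (lift ord0 i)) (x ord0 \o g) (y ord0).
- by [].
- exact: orbit_comp.
- by [].
- by rewrite -xg => /(comp_inj Gg) /injx /eqP; rewrite eq_sym (negPf (neq_lift _ _)).
- by move/injy/eqP; rewrite eq_sym (negPf (neq_lift _ _)).
exists (g \o h); first exact: group_comp.
move=> i; case: (unliftP ord0 i) => [j|] ->; last exact: xh.
by rewrite -Zh -xg.
Qed.

End Transitivity.

(** * Infinite transitivity *)

Theorem theorem2p2 (k : closedFieldType) (chark0 : [pchar k] =i pred0)
    (A : comAlgType k)
    (varA : irreducible_affine_variety A) (dimA : dimension_ge A 2)
    (N : set (A -> A)) (lndN : N `<=` locally_nilpotent_derivation A)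
    (satN : saturated N)
    (G : set (A -> A)) (defG : G = group_generated_by_lnds N)
    (GSAut : G `<=` SAut A)
    (O : set (A -> k)) (orbO : exists2 x, points A x & O = point_orbit G x)
    (openO : zariski_open O) :
  infinitely_transitive G O.
Proof.
have [domA fgA] := varA; have [x0 ptx0 defO] := orbO; subst G O.
have autG := subset_trans GSAut (@SAut_automorphism k A).
apply: orbit_infinitely_transitive => // a a0.
have [I OE] := openO.
have : point_orbit (group_generated_by_lnds N) x0 x0.
  by exists idfun => //; apply: group_id.
rewrite OE => -[_ nx0].
have [b [Ib x0b]] : exists b, I b /\ x0 b != 0.
  apply: contrapT => nb; apply: nx0; split=> // b Ib.
  by apply/eqP/negPn/negP => x0b; apply: nb; exists b.
have b0 : b != 0.
  by apply: contraNneq x0b => ->; have [y ->] := point_pack ptx0; rewrite rmorph0.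
(* O contains the locus where b does not vanish, and that locus meets the one
   of a since A is a domain *)
have [x ptx xab] := nullstellensatz domA fgA (domain_mulf_neq0 domA a0 b0).
have [y xE] := point_pack ptx.
move: xab; rewrite xE rmorphM /= mulf_eq0 negb_or -xE => /andP [xa xb].
by exists x => //; split=> // -[_ /(_ b Ib)]; apply/eqP.
Qed.
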